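(* Let $R$ be an arbitrary ring and let $D_A:\mathrm{fp}(R\text{-}\mathrm{Mod},\mathrm{Ab})\to(\mathrm{mod}\text{-}R,\mathrm{Ab})^{\mathrm{op}}$ be the Auslander-Gruson-Jensen functor. For a functor $F\in\mathrm{fp}(R\text{-}\mathrm{Mod},\mathrm{Ab})$, the following are equivalent. 1. $D_AF=0$. 2. Whenever $X\to Y\to Z$ are morphisms of left $R$-modules such that the induced sequence $0\to(Z,-)\to(Y,-)\to(X,-)\to F\to0$ is exact (for some morphism $(X,-)\to F$), the sequence $0\to X\to Y\to Z\to0$ is pure-exact. 3. There is a pure-exact sequence $0\to X\to Y\to Z\to0$ of left $R$-modules and an exact sequence $0\to(Z,-)\to(Y,-)\to(X,-)\to F\to0$ in which the morphisms between representable functors are induced by those of the pure-exact sequence. 4. For every pure-injective left $R$-module $N$, $FN=0$.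
   Context: All categories and functors are additive. $R\text{-}\mathrm{Mod}$ is the category of left $R$-modules and $\mathrm{mod}\text{-}R$ is the category of finitely presented right $R$-modules. $(X,-)$ denotes the representable (Hom) functor and $(F,G)$ denotes the group of natural transformations $F\to G$; $\otimes=\otimes_R$. $\mathrm{fp}(R\text{-}\mathrm{Mod},\mathrm{Ab})$ is the (abelian) category of finitely presented functors, i.e. additive functors $F:R\text{-}\mathrm{Mod}\to\mathrm{Ab}$ for which there is an exact sequence $(Y,-)\to(X,-)\to F\to0$ with $X,Y\in R\text{-}\mathrm{Mod}$. $(\mathrm{mod}\text{-}R,\mathrm{Ab})$ is the (abelian) category of all additive functors $\mathrm{mod}\text{-}R\to\mathrm{Ab}$. Exactness in both categories is objectwise. The functor $D_A$ is defined by $(D_AF)M=(F,M\otimes-)$ for $F\in\mathrm{fp}(R\text{-}\mathrm{Mod},\mathrm{Ab})$ and $M\in\mathrm{mod}\text{-}R$, where $M\otimes-:R\text{-}\mathrm{Mod}\to\mathrm{Ab}$. A short exact sequence $0\to X\to Y\to Z\to0$ of left $R$-modules is pure-exact if $0\to-\otimes X\to-\otimes Y\to-\otimes Z\to0$ is exact in $(\mathrm{mod}\text{-}R,\mathrm{Ab})$. A left $R$-module $N$ is pure-injective if $(-,N)$ sends pure-exact sequences to exact sequences. *)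

(* Defs.v *)
From HB Require Import structures.
From mathcomp Require Import all_boot all_order all_algebra.
From mathcomp Require Import boolp freeg.

Set Implicit Arguments.
Unset Strict Implicit.
Unset Printing Implicit Defensive.

Import GRing.Theory.
Local Open Scope ring_scope.

(* Values of functors are "large" abelian groups.  The carriers of all MathComp
   algebraic structures live in one common universe u, so that [lmodType R]
   lives strictly above u, and so does the group of natural transformations
   between two functors on R-Mod: it cannot be a [zmodType].  Every [zmodType]
   is an [abgrp] through [ab_of] below. *)
Record abgrp := AbGrp {
  ab_sort :> Type;
  ab0 : ab_sort;
  abD : ab_sort -> ab_sort -> ab_sort;
  abN : ab_sort -> ab_sort;
  abDA : associative abD;
  abDC : commutative abD;
  ab0D : left_id ab0 abD;
  abND : left_inverse ab0 abN abD
}.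
Arguments ab0 {a}.
Arguments abD {a}.
Arguments abN {a}.

Record abhom (A B : abgrp) := AbHom {
  abfun :> A -> B;
  abhomD : forall x y, abfun (abD x y) = abD (abfun x) (abfun y)
}.

Lemma abhomP (A B : abgrp) (f g : abhom A B) : f =1 g -> f = g.
Proof.
case: f g => [f fD] [g gD] /= fg.
have {}fg : f = g by apply/funext.
by case: _ / fg gD => gD; congr AbHom; exact: Prop_irrelevance.
Qed.

Lemma abDI (A : abgrp) (x y z : A) : abD x y = abD x z -> y = z.
Proof.
by move=> /(congr1 (abD (abN x))); rewrite !abDA abND !ab0D.
Qed.

Lemma abD0 (A : abgrp) (x : A) : abD x ab0 = x.
Proof. by rewrite abDC ab0D. Qed.

Lemma abDACA (A : abgrp) (x y z t : A) :
  abD (abD x y) (abD z t) = abD (abD x z) (abD y t).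
Proof. by rewrite -!abDA; congr abD; rewrite !abDA [abD y z]abDC. Qed.

Lemma abhom0 (A B : abgrp) (f : abhom A B) : f ab0 = ab0.
Proof. by apply: (@abDI _ (f ab0)); rewrite -abhomD ab0D abD0. Qed.

Lemma abNdist (A : abgrp) (x y : A) : abN (abD x y) = abD (abN x) (abN y).
Proof.
apply: (@abDI _ (abD x y)); rewrite abDC abND abDACA.
by rewrite ![abD _ (abN _)]abDC !abND ab0D.
Qed.

Lemma abhomN (A B : abgrp) (f : abhom A B) x : f (abN x) = abN (f x).
Proof.
apply: (@abDI _ (f x)); rewrite -abhomD.
by rewrite ![abD _ (abN _)]abDC !abND abhom0.
Qed.

Definition ab_of (U : zmodType) : abgrp :=
  @AbGrp U 0 +%R -%R (@addrA U) (@addrC U) (@add0r U) (@addNr U).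

Definition abhom_of (U V : zmodType) (f : {additive U -> V}) :
    abhom (ab_of U) (ab_of V) :=
  @AbHom (ab_of U) (ab_of V) f (raddfD f).

Definition abid (A : abgrp) : abhom A A := @AbHom A A id (fun _ _ => erefl).

Lemma abcomp_subproof (A B C : abgrp) (g : abhom B C) (f : abhom A B) x y :
  g (f (abD x y)) = abD (g (f x)) (g (f y)).
Proof. by rewrite !abhomD. Qed.

Definition abcomp (A B C : abgrp) (g : abhom B C) (f : abhom A B) : abhom A C :=
  @AbHom A C (fun x => g (f x)) (abcomp_subproof g f).

Section AbHomGroup.
Variables A B : abgrp.

Lemma abhom_zero_subproof (x y : A) : ab0 = abD ab0 ab0 :> B.
Proof. by rewrite ab0D. Qed.
Definition abhom_zero : abhom A B :=
  @AbHom A B (fun=> ab0) abhom_zero_subproof.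

Lemma abhom_add_subproof (f g : abhom A B) x y :
  abD (f (abD x y)) (g (abD x y)) = abD (abD (f x) (g x)) (abD (f y) (g y)).
Proof. by rewrite !abhomD abDACA. Qed.
Definition abhom_add (f g : abhom A B) : abhom A B :=
  @AbHom A B (fun x => abD (f x) (g x)) (abhom_add_subproof f g).

Lemma abhom_opp_subproof (f : abhom A B) x y :
  abN (f (abD x y)) = abD (abN (f x)) (abN (f y)).
Proof. by rewrite abhomD abNdist. Qed.
Definition abhom_opp (f : abhom A B) : abhom A B :=
  @AbHom A B (fun x => abN (f x)) (abhom_opp_subproof f).

End AbHomGroup.
Arguments abhom_zero {A B}.

Definition ab_inj (A B : abgrp) (u : abhom A B) : Prop := injective u.
Definition ab_surj (A B : abgrp) (u : abhom A B) : Prop :=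
  forall y, exists x, u x = y.
Definition ab_exact (A B C : abgrp) (u : abhom A B) (v : abhom B C) : Prop :=
  forall y, v y = ab0 <-> exists x, u x = y.
Definition ab_ses (A B C : abgrp) (u : abhom A B) (v : abhom B C) : Prop :=
  [/\ ab_inj u, ab_exact u v & ab_surj v].

Record preaddcat := PreAddCat {
  obj :> Type;
  mor : obj -> obj -> abgrp;
  idm : forall X, mor X X;
  cmp : forall X Y Z, mor Y Z -> mor X Y -> mor X Z;
  cmp1m : forall X Y (f : mor X Y), cmp (idm Y) f = f;
  cmpm1 : forall X Y (f : mor X Y), cmp f (idm X) = f;
  cmpA : forall X Y Z T (h : mor Z T) (g : mor Y Z) (f : mor X Y),
    cmp h (cmp g f) = cmp (cmp h g) f;
  cmpDl : forall X Y Z (g g' : mor Y Z) (f : mor X Y),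
    cmp (abD g g') f = abD (cmp g f) (cmp g' f);
  cmpDr : forall X Y Z (g : mor Y Z) (f f' : mor X Y),
    cmp g (abD f f') = abD (cmp g f) (cmp g f')
}.
Arguments mor {p}.
Arguments idm {p}.
Arguments cmp {p X Y Z}.

(* [fmapD] makes these the additive functors C -> Ab. *)
Record functor (C : preaddcat) := Functor {
  fobj :> C -> abgrp;
  fmap : forall X Y : C, mor X Y -> abhom (fobj X) (fobj Y);
  fmap_id : forall X : C, fmap (idm X) = abid (fobj X);
  fmap_cmp : forall (X Y Z : C) (g : mor Y Z) (f : mor X Y),
    fmap (cmp g f) = abcomp (fmap g) (fmap f);
  fmapD : forall (X Y : C) (f g : mor X Y),
    fmap (abD f g) = abhom_add (fmap f) (fmap g)
}.
Arguments fmap {C} f {X Y} : rename.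

Record nattrans (C : preaddcat) (F G : functor C) := NatTrans {
  ncomp :> forall X : C, abhom (F X) (G X);
  natural : forall (X Y : C) (f : mor X Y) (x : F X),
    ncomp Y (fmap F f x) = fmap G f (ncomp X x)
}.

Section Functors.
Variable C : preaddcat.
Implicit Types F G H K : functor C.

Lemma nattransP F G (s t : nattrans F G) : (forall X x, s X x = t X x) -> s = t.
Proof.
case: s t => [s sn] [t tn] /= st.
have {}st : s = t.
  by apply: functional_extensionality_dep => X; apply: abhomP => x; exact: st.
by case: _ / st tn => tn; congr NatTrans; exact: Prop_irrelevance.
Qed.

Lemma natcomp_subproof F G H (t : nattrans G H) (s : nattrans F G)
    (X Y : C) (f : mor X Y) (x : F X) :
  abcomp (t Y) (s Y) (fmap F f x) = fmap H f (abcomp (t X) (s X) x).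
Proof. by rewrite /= !natural. Qed.
Definition natcomp F G H (t : nattrans G H) (s : nattrans F G) : nattrans F H :=
  NatTrans (natcomp_subproof t s).

Section NatGroup.
Variables F G : functor C.

Lemma nat_zero_subproof (X Y : C) (f : mor X Y) (x : F X) :
  (@abhom_zero (F Y) (G Y)) (fmap F f x) =
  fmap G f ((@abhom_zero (F X) (G X)) x).
Proof. by rewrite /= abhom0. Qed.
Definition nat_zero : nattrans F G := NatTrans nat_zero_subproof.

Lemma nat_add_subproof (s t : nattrans F G) (X Y : C) (f : mor X Y) (x : F X) :
  abhom_add (s Y) (t Y) (fmap F f x) = fmap G f (abhom_add (s X) (t X) x).
Proof. by rewrite /= !natural abhomD. Qed.
Definition nat_add (s t : nattrans F G) : nattrans F G :=
  NatTrans (nat_add_subproof s t).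

Lemma nat_opp_subproof (s : nattrans F G) (X Y : C) (f : mor X Y) (x : F X) :
  abhom_opp (s Y) (fmap F f x) = fmap G f (abhom_opp (s X) x).
Proof. by rewrite /= natural abhomN. Qed.
Definition nat_opp (s : nattrans F G) : nattrans F G :=
  NatTrans (nat_opp_subproof s).

Lemma nat_addA : associative nat_add.
Proof. by move=> s t u; apply: nattransP => X x /=; rewrite abDA. Qed.
Lemma nat_addC : commutative nat_add.
Proof. by move=> s t; apply: nattransP => X x /=; rewrite abDC. Qed.
Lemma nat_add0 : left_id nat_zero nat_add.
Proof. by move=> s; apply: nattransP => X x /=; rewrite ab0D. Qed.
Lemma nat_addN : left_inverse nat_zero nat_opp nat_add.
Proof. by move=> s; apply: nattransP => X x /=; rewrite abND. Qed.

Definition nat_ab : abgrp := AbGrp nat_addA nat_addC nat_add0 nat_addN.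

End NatGroup.

Definition is_zero F : Prop := forall (X : C) (x : F X), x = ab0.

Definition nat_inj F G (u : nattrans F G) : Prop := forall X, ab_inj (u X).
Definition nat_surj F G (u : nattrans F G) : Prop := forall X, ab_surj (u X).
Definition nat_exact F G H (u : nattrans F G) (v : nattrans G H) : Prop :=
  forall X, ab_exact (u X) (v X).
Definition nat_ses F G H (u : nattrans F G) (v : nattrans G H) : Prop :=
  [/\ nat_inj u, nat_exact u v & nat_surj v].

(* The representable functor (X,-), and the natural transformation
   (Y,-) -> (X,-) induced by f : X -> Y. *)
Section Representable.
Variable X : C.

Definition rep_fmap (Y Z : C) (g : mor Y Z) : abhom (mor X Y) (mor X Z) :=
  @AbHom (mor X Y) (mor X Z) (cmp g) (cmpDr g).

Lemma rep_fmap_id Y : rep_fmap (idm Y) = abid (mor X Y).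
Proof. by apply: abhomP => h; exact: cmp1m. Qed.
Lemma rep_fmap_cmp (Y Z T : C) (g : mor Z T) (f : mor Y Z) :
  rep_fmap (cmp g f) = abcomp (rep_fmap g) (rep_fmap f).
Proof. by apply: abhomP => h /=; rewrite cmpA. Qed.
Lemma rep_fmapD (Y Z : C) (f g : mor Y Z) :
  rep_fmap (abD f g) = abhom_add (rep_fmap f) (rep_fmap g).
Proof. by apply: abhomP => h; exact: cmpDl. Qed.

Definition rep : functor C := Functor rep_fmap_id rep_fmap_cmp rep_fmapD.

End Representable.

Section RepMap.
Variables (X Y : C) (f : mor X Y).

Definition rep_precomp (Z : C) : abhom (rep Y Z) (rep X Z) :=
  @AbHom (rep Y Z) (rep X Z) (fun h => cmp h f) (fun h h' => cmpDl h h' f).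

Lemma rep_precomp_natural (Z T : C) (g : mor Z T) (h : rep Y Z) :
  rep_precomp T (fmap (rep Y) g h) = fmap (rep X) g (rep_precomp Z h).
Proof. by rewrite /= cmpA. Qed.

Definition rep_map : nattrans (rep Y) (rep X) := NatTrans rep_precomp_natural.

End RepMap.

Definition fp_functor F : Prop :=
  exists (X Y : C) (u : nattrans (rep Y) (rep X)) (p : nattrans (rep X) F),
    nat_exact u p /\ nat_surj p.

(* 0 -> (Z,-) -> (Y,-) -> (X,-) -> F -> 0, induced by X -f-> Y -g-> Z *)
Definition rep_resolution (X Y Z : C) (f : mor X Y) (g : mor Y Z)
    F (p : nattrans (rep X) F) : Prop :=
  [/\ nat_inj (rep_map g), nat_exact (rep_map g) (rep_map f),
      nat_exact (rep_map f) p & nat_surj p].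

End Functors.

Section Modules.
Variable R : pzRingType.

Lemma linP (X Y : lmodType R) (f g : {linear X -> Y}) : f =1 g -> f = g.
Proof.
case: f g => [f [[fA] [fZ]]] [g [[gA] [gZ]]] /= fg.
have {}fg : f = g by apply/funext.
case: _ / fg gA gZ => gA gZ.
by rewrite (Prop_irrelevance fA gA) (Prop_irrelevance fZ gZ).
Qed.

Section LinGroup.
Variables X Y : lmodType R.

Definition lin0 : {linear X -> Y} := \0.
Definition linD (f g : {linear X -> Y}) : {linear X -> Y} := f \+ g.
Definition linN (f : {linear X -> Y}) : {linear X -> Y} := \- f.

Lemma linDA : associative linD.
Proof. by move=> f g h; apply: linP => x /=; rewrite addrA. Qed.
Lemma linDC : commutative linD.
Proof. by move=> f g; apply: linP => x /=; rewrite addrC. Qed.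
Lemma lin0D : left_id lin0 linD.
Proof. by move=> f; apply: linP => x /=; rewrite add0r. Qed.
Lemma linND : left_inverse lin0 linN linD.
Proof. by move=> f; apply: linP => x /=; rewrite addNr. Qed.

Definition lin_ab : abgrp := AbGrp linDA linDC lin0D linND.

End LinGroup.

Definition linid (X : lmodType R) : {linear X -> X} := idfun.
Definition lincomp (X Y Z : lmodType R)
    (g : {linear Y -> Z}) (f : {linear X -> Y}) : {linear X -> Z} := g \o f.

Lemma lincomp1m X Y (f : lin_ab X Y) : lincomp (linid Y) f = f.
Proof. exact: linP. Qed.
Lemma lincompm1 X Y (f : lin_ab X Y) : lincomp f (linid X) = f.
Proof. exact: linP. Qed.
Lemma lincompA X Y Z T (h : lin_ab Z T) (g : lin_ab Y Z) (f : lin_ab X Y) :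
  lincomp h (lincomp g f) = lincomp (lincomp h g) f.
Proof. exact: linP. Qed.
Lemma lincompDl X Y Z (g g' : lin_ab Y Z) (f : lin_ab X Y) :
  lincomp (abD g g') f = abD (lincomp g f : lin_ab X Z) (lincomp g' f).
Proof. exact: linP. Qed.
Lemma lincompDr X Y Z (g : lin_ab Y Z) (f f' : lin_ab X Y) :
  lincomp g (abD f f') = abD (lincomp g f : lin_ab X Z) (lincomp g f').
Proof. by apply: linP => x /=; rewrite raddfD. Qed.

Definition LMod : preaddcat :=
  @PreAddCat (lmodType R) lin_ab linid lincomp
    lincomp1m lincompm1 lincompA lincompDl lincompDr.

Definition mod_ses (X Y Z : lmodType R)
    (f : {linear X -> Y}) (g : {linear Y -> Z}) : Prop :=
  [/\ injective f, (forall y, g y = 0 <-> exists x, f x = y)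
    & forall z, exists y, g y = z].

Definition fin_pres (M : lmodType R) : Prop :=
  exists (m n : nat) (f : {linear 'rV[R]_m -> 'rV[R]_n})
         (g : {linear 'rV[R]_n -> M}),
    (forall y, g y = 0 <-> exists x, f x = y) /\ (forall z, exists y, g y = z).

Record fpmod := FpMod { fpmod_mod :> lmodType R; fpmodP : fin_pres fpmod_mod }.

Definition fpLMod : preaddcat :=
  @PreAddCat fpmod (fun M N => lin_ab M N)
    (fun M => linid M) (fun M N P => @lincomp M N P)
    (fun M N => @lincomp1m M N) (fun M N => @lincompm1 M N)
    (fun M N P Q => @lincompA M N P Q) (fun M N P => @lincompDl M N P)
    (fun M N P => @lincompDr M N P).

End Modules.

(* A right R-module is a left module over the converse ring R^c; the action of
   r on the right of m is [(r : R^c) *: m]. *)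
Definition modR (R : pzRingType) : preaddcat := fpLMod R^c.

Section Tensor.
Variables (R : pzRingType) (M : lmodType R^c) (X : lmodType R).

Definition tens_free : zmodType := {freeg (M * X)}.

Inductive tens_rel : tens_free -> Prop :=
| TensRel0 : tens_rel 0
| TensRelB u v : tens_rel u -> tens_rel v -> tens_rel (u - v)
| TensRelDl m m' x : tens_rel (<< (m + m', x) >> - (<< (m, x) >> + << (m', x) >>))
| TensRelDr m x x' : tens_rel (<< (m, x + x') >> - (<< (m, x) >> + << (m, x') >>))
| TensRelZ (r : R) m x :
    tens_rel (<< ((r : R^c) *: m, x) >> - << (m, r *: x) >>).

Definition tens_relb (u : tens_free) : bool := `[< tens_rel u >].

Lemma tens_rel_closed : zmod_closed tens_relb.
Proof.
split; first by apply/asboolP; exact: TensRel0.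
by move=> u v /asboolP ru /asboolP rv; apply/asboolP; exact: TensRelB.
Qed.

HB.instance Definition _ :=
  GRing.isZmodClosed.Build tens_free tens_relb tens_rel_closed.

Definition tens : zmodType :=
  Quotient.quot (GRing.ZmodClosed.clone tens_free tens_relb _).

Definition tens_pi (u : tens_free) : tens := (\pi_tens u)%qT.
Definition tens_pure (m : M) (x : X) : tens := tens_pi << (m, x) >>.

Lemma tens_piB : {morph tens_pi : u v / u - v}.
Proof. by move=> u v; rewrite /tens_pi !piE. Qed.

Lemma tens_pi_eq u v : tens_pi u = tens_pi v <-> tens_rel (u - v).
Proof.
split=> [/eqP|r]; last apply/eqP; rewrite /tens_pi -Quotient.idealrBE.
  by move=> /asboolP.
exact/asboolP.
Qed.

Lemma tens_pi_surj (t : tens) : tens_pi (repr t) = t.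
Proof. exact: reprK. Qed.

HB.instance Definition _ := GRing.isZmodMorphism.Build tens_free tens tens_pi tens_piB.

Lemma tens_pureDl m m' x :
  tens_pure (m + m') x = tens_pure m x + tens_pure m' x.
Proof. by rewrite -raddfD; apply/tens_pi_eq; exact: TensRelDl. Qed.

Lemma tens_pureDr m x x' :
  tens_pure m (x + x') = tens_pure m x + tens_pure m x'.
Proof. by rewrite -raddfD; apply/tens_pi_eq; exact: TensRelDr. Qed.

Lemma tens_pureZ (r : R) m x :
  tens_pure ((r : R^c) *: m) x = tens_pure m (r *: x).
Proof. by apply/tens_pi_eq; exact: TensRelZ. Qed.

Definition balanced (A : zmodType) (h : M -> X -> A) : Prop :=
  [/\ forall m m' x, h (m + m') x = h m x + h m' x,
      forall m x x', h m (x + x') = h m x + h m x'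
    & forall (r : R) m x, h ((r : R^c) *: m) x = h m (r *: x)].

Lemma tens_ext (A : zmodType) (f g : {additive tens -> A}) :
  (forall m x, f (tens_pure m x) = g (tens_pure m x)) -> f =1 g.
Proof.
move=> fg t; rewrite -(tens_pi_surj t).
elim/freeg_ind_dom0: (repr t) => [|k [m x] D _ _ IH]; first by rewrite !raddf0.
rewrite !raddfD /= IH; congr (_ + _).
have -> : << k *g (m, x) >> = << (m, x) >> *~ k :> tens_free.
  by rewrite freegU_mulz intz.
by rewrite !raddfMz; congr (_ *~ _); exact: fg.
Qed.

Section Lift.
Variables (A : zmodType) (h : M -> X -> A) (hb : balanced h).

Let lift (u : tens_free) : A := fglift (fun p => h p.1 p.2 : zmodule A) u.

Let liftB : {morph lift : u v / u - v}.
Proof. move=> u v; exact: (@lift_is_additive _ _ (zmodule A)). Qed.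

HB.instance Definition _ := GRing.isZmodMorphism.Build tens_free A lift liftB.

Let lift_pure m x : lift << (m, x) >> = h m x.
Proof. by rewrite /lift liftU scale1r. Qed.

Let lift_rel u : tens_rel u -> lift u = 0.
Proof.
case: hb => hDl hDr hZ.
elim=> [|{}u v _ u0 _ v0|m m' x|m x x'|r m x]; first exact: raddf0.
- by rewrite raddfB /= u0 v0 subr0.
- by rewrite raddfB raddfD /= !lift_pure /= hDl subrr.
- by rewrite raddfB raddfD /= !lift_pure /= hDr subrr.
- by rewrite raddfB /= !lift_pure /= hZ subrr.
Qed.

Definition tens_lift_fun (t : tens) : A := lift (repr t).

Let tens_lift_pi u : tens_lift_fun (tens_pi u) = lift u.
Proof.
apply/eqP; rewrite -subr_eq0 -raddfB; apply/eqP/lift_rel/tens_pi_eq.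
exact: tens_pi_surj.
Qed.

Lemma tens_lift_funB : {morph tens_lift_fun : s t / s - t}.
Proof.
move=> s t; rewrite -(tens_pi_surj s) -(tens_pi_surj t) -raddfB.
by rewrite !tens_lift_pi raddfB.
Qed.

HB.instance Definition _ :=
  GRing.isZmodMorphism.Build tens A tens_lift_fun tens_lift_funB.

Definition tens_lift : {additive tens -> A} := tens_lift_fun.

Lemma tens_lift_pure m x : tens_lift (tens_pure m x) = h m x.
Proof. by rewrite [LHS]tens_lift_pi lift_pure. Qed.

End Lift.

End Tensor.

Section TensorMap.
Variable R : pzRingType.
Implicit Types (M N P : lmodType R^c) (X Y Z : lmodType R).

Lemma tens_map_balanced M N X Y (f : {linear M -> N}) (g : {linear X -> Y}) :
  balanced (fun (m : M) (x : X) => tens_pure (f m) (g x)).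
Proof.
split=> [m m' x|m x x'|r m x]; first by rewrite raddfD tens_pureDl.
- by rewrite raddfD tens_pureDr.
- by rewrite !linearZ /= tens_pureZ.
Qed.

Definition tens_map M N X Y (f : {linear M -> N}) (g : {linear X -> Y}) :
    {additive tens M X -> tens N Y} :=
  tens_lift (tens_map_balanced f g).

Lemma tens_map_pure M N X Y (f : {linear M -> N}) (g : {linear X -> Y}) m x :
  tens_map f g (tens_pure m x) = tens_pure (f m) (g x).
Proof. exact: tens_lift_pure. Qed.

Lemma tens_map_id M X : tens_map (linid M) (linid X) =1 id.
Proof.
by apply: (tens_ext (g := idfun)) => m x; rewrite tens_map_pure.
Qed.

Lemma tens_map_comp M N P X Y Z (f' : {linear N -> P}) (f : {linear M -> N})
    (g' : {linear Y -> Z}) (g : {linear X -> Y}) t :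
  tens_map (lincomp f' f) (lincomp g' g) t = tens_map f' g' (tens_map f g t).
Proof.
apply: (tens_ext (f := tens_map (lincomp f' f) (lincomp g' g))
  (g := tens_map f' g' \o tens_map f g)) => m x.
by rewrite [LHS]tens_map_pure [RHS]/= !tens_map_pure.
Qed.

Lemma tens_map_compl M N P X (g : {linear N -> P}) (f : {linear M -> N}) t :
  tens_map (lincomp g f) (linid X) t =
  tens_map g (linid X) (tens_map f (linid X) t).
Proof. by rewrite -tens_map_comp (lincompm1 (linid X)). Qed.

Lemma tens_map_compr M X Y Z (g : {linear Y -> Z}) (f : {linear X -> Y}) t :
  tens_map (linid M) (lincomp g f) t =
  tens_map (linid M) g (tens_map (linid M) f t).
Proof. by rewrite -tens_map_comp (lincompm1 (linid M)). Qed.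

Lemma tens_map_swap M N X Y (f : {linear M -> N}) (g : {linear X -> Y}) t :
  tens_map f (linid Y) (tens_map (linid M) g t) =
  tens_map (linid N) g (tens_map f (linid X) t).
Proof.
by rewrite -!tens_map_comp !(lincompm1 f, lincompm1 g, lincomp1m f, lincomp1m g).
Qed.

Lemma tens_mapDl M N X Y (f f' : {linear M -> N}) (g : {linear X -> Y}) t :
  tens_map (linD f f') g t = tens_map f g t + tens_map f' g t.
Proof.
apply: (tens_ext (f := tens_map (linD f f') g)
  (g := tens_map f g \+ tens_map f' g)) => m x.
by rewrite [LHS]tens_map_pure tens_pureDl [RHS]/= !tens_map_pure.
Qed.

Lemma tens_mapDr M N X Y (f : {linear M -> N}) (g g' : {linear X -> Y}) t :
  tens_map f (linD g g') t = tens_map f g t + tens_map f g' t.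
Proof.
apply: (tens_ext (f := tens_map f (linD g g'))
  (g := tens_map f g \+ tens_map f g')) => m x.
by rewrite [LHS]tens_map_pure tens_pureDr [RHS]/= !tens_map_pure.
Qed.

(* [tensl M] is M (x) - on R-Mod; [tensr X] below is - (x) X on mod-R. *)
Section TensL.
Variable M : lmodType R^c.

Definition tensl_obj (X : LMod R) : abgrp := ab_of (tens M X).
Definition tensl_fmap (X Y : LMod R) (g : mor X Y) :
    abhom (tensl_obj X) (tensl_obj Y) :=
  abhom_of (tens_map (linid M) (g : {linear X -> Y})).

Lemma tensl_id (X : LMod R) : tensl_fmap (idm X) = abid (tensl_obj X).
Proof. by apply: abhomP => t; exact: tens_map_id. Qed.

Lemma tensl_cmp (X Y Z : LMod R) (g : mor Y Z) (f : mor X Y) :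
  tensl_fmap (cmp g f) = abcomp (tensl_fmap g) (tensl_fmap f).
Proof.
by apply: abhomP => t; exact: tens_map_compr.
Qed.

Lemma tensl_add (X Y : LMod R) (f g : mor X Y) :
  tensl_fmap (abD f g) = abhom_add (tensl_fmap f) (tensl_fmap g).
Proof. by apply: abhomP => t; exact: tens_mapDr. Qed.

Definition tensl : functor (LMod R) := Functor tensl_id tensl_cmp tensl_add.

End TensL.

Section TensLMap.
Variables (M N : lmodType R^c) (f : {linear M -> N}).

Definition tensl_map_fun (X : LMod R) : abhom (tensl M X) (tensl N X) :=
  abhom_of (tens_map f (linid X)).

Lemma tensl_map_natural (X Y : LMod R) (g : mor X Y) (t : tensl M X) :
  tensl_map_fun Y (fmap (tensl M) g t) = fmap (tensl N) g (tensl_map_fun X t).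
Proof. exact: tens_map_swap. Qed.

Definition tensl_map : nattrans (tensl M) (tensl N) :=
  NatTrans tensl_map_natural.

End TensLMap.

Section TensR.
Variable X : lmodType R.

Definition tensr_obj (M : modR R) : abgrp := ab_of (tens M X).
Definition tensr_fmap (M N : modR R) (f : mor M N) :
    abhom (tensr_obj M) (tensr_obj N) :=
  abhom_of (tens_map (f : {linear M -> N}) (linid X)).

Lemma tensr_id (M : modR R) : tensr_fmap (idm M) = abid (tensr_obj M).
Proof. by apply: abhomP => t; exact: tens_map_id. Qed.

Lemma tensr_cmp (M N P : modR R) (g : mor N P) (f : mor M N) :
  tensr_fmap (cmp g f) = abcomp (tensr_fmap g) (tensr_fmap f).
Proof.
by apply: abhomP => t; exact: tens_map_compl.
Qed.

Lemma tensr_add (M N : modR R) (f g : mor M N) :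
  tensr_fmap (abD f g) = abhom_add (tensr_fmap f) (tensr_fmap g).
Proof. by apply: abhomP => t; exact: tens_mapDl. Qed.

Definition tensr : functor (modR R) := Functor tensr_id tensr_cmp tensr_add.

End TensR.

Section TensRMap.
Variables (X Y : lmodType R) (g : {linear X -> Y}).

Definition tensr_map_fun (M : modR R) : abhom (tensr X M) (tensr Y M) :=
  abhom_of (tens_map (linid M) g).

Lemma tensr_map_natural (M N : modR R) (f : mor M N) (t : tensr X M) :
  tensr_map_fun N (fmap (tensr X) f t) = fmap (tensr Y) f (tensr_map_fun M t).
Proof. exact/esym/tens_map_swap. Qed.

Definition tensr_map : nattrans (tensr X) (tensr Y) :=
  NatTrans tensr_map_natural.

End TensRMap.

Definition pure_exact (X Y Z : LMod R) (f : mor X Y) (g : mor Y Z) : Prop :=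
  @mod_ses R X Y Z f g /\ nat_ses (tensr_map f) (tensr_map g).

(* [rep_map g N] is precomposition with g, from (Z,N) to (Y,N). *)
Definition pure_injective (N : LMod R) : Prop :=
  forall (X Y Z : LMod R) (f : mor X Y) (g : mor Y Z),
    pure_exact f g -> ab_ses (rep_map g N) (rep_map f N).

(* The Auslander-Gruson-Jensen functor on objects: (DA F) M = (F, M (x) -). *)
Section DA.
Variable F : functor (LMod R).

Definition DA_obj (M : modR R) : abgrp := nat_ab F (tensl M).

Lemma DA_fmapD (M N : modR R) (f : mor M N) (s t : DA_obj M) :
  natcomp (tensl_map f) (abD s t) =
  abD (natcomp (tensl_map f) s : DA_obj N) (natcomp (tensl_map f) t).
Proof. by apply: nattransP => X x; exact: abhomD. Qed.

Definition DA_fmap (M N : modR R) (f : mor M N) :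
    abhom (DA_obj M) (DA_obj N) :=
  @AbHom (DA_obj M) (DA_obj N) (natcomp (tensl_map f)) (DA_fmapD f).

Lemma DA_id (M : modR R) : DA_fmap (idm M) = abid (DA_obj M).
Proof.
by apply: abhomP => s; apply: nattransP => X x; exact: tens_map_id.
Qed.

Lemma DA_cmp (M N P : modR R) (g : mor N P) (f : mor M N) :
  DA_fmap (cmp g f) = abcomp (DA_fmap g) (DA_fmap f).
Proof.
by apply: abhomP => s; apply: nattransP => X x; exact: tens_map_compl.
Qed.

Lemma DA_add (M N : modR R) (f g : mor M N) :
  DA_fmap (abD f g) = abhom_add (DA_fmap f) (DA_fmap g).
Proof.
by apply: abhomP => s; apply: nattransP => X x; exact: tens_mapDl.
Qed.

Definition DA : functor (modR R) := Functor DA_id DA_cmp DA_add.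

End DA.

End TensorMap.

(* Main.v *)
Require Import Defs.
From HB Require Import structures.
From mathcomp Require Import all_boot all_order all_algebra.
From mathcomp Require Import boolp classical_sets freeg.

(** By the Yoneda lemma, [F] is the cokernel of the map (Y,-) -> (X,-) induced by
some [f : X -> Y], and a natural transformation from [F] to M (x) - is an
element of M (x) X killed by M (x) f.  Hence D_A F vanishes exactly when M (x) f
is injective for every finitely presented M ([DA_eq0P]).  On the other hand
0 -> (Z,-) -> (Y,-) -> (X,-) is exact exactly when X -> Y -> Z -> 0 is
([rep_cokernelP]), and then so is M (x) X -> M (x) Y -> M (x) Z -> 0
([tens_surj], [tens_exact]); so purity of such a sequence is once more the
injectivity of all the M (x) f, injectivity of [f] itself being the case M = R.
This makes the first three conditions equivalent, a resolution being obtained by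
taking for Z the cokernel of [f].

If [f] begins a pure-exact sequence, every morphism X -> N into a pure-injective
N extends along [f], which says that F N = 0.  For the way back from pure-injectives, the test objects are the
character modules [dual M], that is, Hom(M, Q/Z).  As a morphism X -> [dual M]
is the same as a character of M (x) X, morphisms into [dual M] extend along [f]
if and only if characters extend along M (x) f.  Since Q/Z is an injective
abelian group ([additive_extend]), [dual M] is pure-injective for finitely
presented M ([dual_pure_injective]); since Q/Z cogenerates abelian groups
([additive_separate]), F vanishing on [dual M] forces M (x) f to be injective
([dual_test_inj]). *)

Set Implicit Arguments.
Unset Strict Implicit.
Unset Printing Implicit Defensive.

Import Order.TTheory GRing.Theory Num.Theory.
Local Open Scope ring_scope.

(** * Cokernels *)

Section Cokernel.
Variables (U V : zmodType) (f : {additive U -> V}).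

Definition im_pred (v : V) : bool := `[< exists u, f u = v >].

Lemma im_pred_closed : zmod_closed im_pred.
Proof.
split=> [|v w /asboolP[a <-] /asboolP[b <-]]; apply/asboolP.
  by exists 0; rewrite raddf0.
by exists (a - b); rewrite raddfB.
Qed.

HB.instance Definition _ :=
  GRing.isZmodClosed.Build V im_pred im_pred_closed.

Definition coker : zmodType :=
  Quotient.quot (GRing.ZmodClosed.clone V im_pred _).

Definition coker_pi (v : V) : coker := (\pi_coker v)%qT.

Lemma coker_piB : {morph coker_pi : u v / u - v}.
Proof. by move=> u v; rewrite /coker_pi !piE. Qed.

HB.instance Definition _ :=
  GRing.isZmodMorphism.Build V coker coker_pi coker_piB.

Lemma coker_pi_eq0 v : coker_pi v = 0 <-> exists u, f u = v.
Proof.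
rewrite -(raddf0 coker_pi) /coker_pi; split=> [/eqP|im_v]; last apply/eqP.
  by rewrite -Quotient.idealrBE subr0 => /asboolP.
by rewrite -Quotient.idealrBE subr0; apply/asboolP.
Qed.

Lemma coker_pi_repr (c : coker) : coker_pi (repr c) = c.
Proof. exact: reprK. Qed.

Lemma coker_pi_surj (c : coker) : exists v, coker_pi v = c.
Proof. by exists (repr c); exact: coker_pi_repr. Qed.

End Cokernel.

Section LinearCokernel.
Variables (R : pzRingType) (X Y : lmodType R) (f : {linear X -> Y}).

(** A separate type because the scaling exists only when the additive map [f]
is linear. *)
Definition coker_mod : Type := coker f.
HB.instance Definition _ := GRing.Zmodule.on coker_mod.

Definition coker_scale (a : R) (c : coker_mod) : coker_mod :=
  coker_pi f (a *: repr c).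

Lemma coker_scale_pi a y : coker_scale a (coker_pi f y) = coker_pi f (a *: y).
Proof.
apply/eqP; rewrite -subr_eq0 -raddfB /= -scalerBr; apply/eqP/coker_pi_eq0.
have /coker_pi_eq0[x fx] : coker_pi f (repr (coker_pi f y) - y) = 0.
  by rewrite raddfB /= coker_pi_repr subrr.
by exists (a *: x); rewrite -fx; exact: linearZ.
Qed.

Lemma coker_scaleA a b c :
  coker_scale a (coker_scale b c) = coker_scale (a * b) c.
Proof. by rewrite coker_scale_pi scalerA. Qed.

Lemma coker_scale1 : left_id 1 coker_scale.
Proof. by move=> c; rewrite /coker_scale scale1r coker_pi_repr. Qed.

Lemma coker_scaleDr : right_distributive coker_scale +%R.
Proof.
move=> a c d; rewrite -(coker_pi_repr c) -(coker_pi_repr d) -raddfD /=.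
by rewrite !coker_scale_pi scalerDr raddfD.
Qed.

Lemma coker_scaleDl c : {morph coker_scale^~ c : a b / a + b}.
Proof. by move=> a b; rewrite /coker_scale scalerDl raddfD. Qed.

HB.instance Definition _ := GRing.Zmodule_isLmodule.Build R coker_mod
  coker_scaleA coker_scale1 coker_scaleDr coker_scaleDl.

Definition coker_proj_fun (y : Y) : coker_mod := coker_pi f y.

Lemma coker_proj_linear : linear coker_proj_fun.
Proof.
move=> a u v; rewrite /coker_proj_fun raddfD /=; congr (_ + _).
by rewrite -coker_scale_pi.
Qed.

HB.instance Definition _ :=
  GRing.isLinear.Build R Y coker_mod *:%R coker_proj_fun coker_proj_linear.

Definition coker_proj : {linear Y -> coker_mod} := coker_proj_fun.

Lemma coker_proj_eq0 y : coker_proj y = 0 <-> exists x, f x = y.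
Proof. exact: coker_pi_eq0. Qed.

Lemma coker_proj_surj (c : coker_mod) : exists y, coker_proj y = c.
Proof. exists (repr (c : coker f)); exact: coker_pi_repr. Qed.

End LinearCokernel.

Lemma linear_factor (R : pzRingType) (Y Z N : lmodType R)
    (g : {linear Y -> Z}) (h : {linear Y -> N}) :
  (forall z, exists y, g y = z) -> (forall y, g y = 0 -> h y = 0) ->
  exists k : {linear Z -> N}, forall y, k (g y) = h y.
Proof.
move=> g_surj g_h; pose s z := projT1 (cid (g_surj z)).
have gs z : g (s z) = z by rewrite /s; case: cid.
pose k z := h (s z).
have kg y : k (g y) = h y.
  have := g_h (s (g y) - y); rewrite !raddfB /= gs subrr => /(_ erefl)/eqP.
  by rewrite subr_eq0 => /eqP.
have k_lin : linear k.
  move=> a u v; have <- : g (a *: s u + s v) = a *: u + v by rewrite linearP !gs.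
  by rewrite kg linearP.
pose kl : {linear Z -> N} := HB.pack k (GRing.isLinear.Build R Z N *:%R k k_lin).
by exists kl.
Qed.

(** * Q/Z as an injective cogenerator of abelian groups *)

(** Divisibility (any [e]) and the presence of torsion of every order ([e = 0])
in one condition: when a homomorphism is extended to one more element, its value
there may be prescribed to be nonzero. *)
Definition injective_cogenerator (D : zmodType) : Prop :=
  forall (k : nat) (e : D), (1 < k)%N -> exists2 d, d != 0 & d *+ k = e.

Definition QZ : zmodType := coker (intmul (1 : rat) : {additive int -> rat}).

(** The classes of [q / k] and [(q + 1) / k] are both k-th parts of the class of
[q], and they differ by that of [1 / k], so one of them is nonzero. *)
Lemma QZ_injective_cogenerator : injective_cogenerator QZ.
Proof.
pose pi : {additive rat -> QZ} :=
  coker_pi (intmul (1 : rat) : {additive int -> rat}).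
move=> k e k1; have [q piq] : exists q, pi q = e by exact: coker_pi_surj.
have k0 : k%:R != 0 :> rat by rewrite pnatr_eq0 -lt0n ltnW.
have piK (n : int) : pi ((q + n%:~R) / k%:R) *+ k = e.
  rewrite (_ : pi _ *+ k = pi (q + n%:~R)); last first.
    by rewrite -raddfMn -[_ *+ k]mulr_natr divfK.
  have -> : pi (q + n%:~R) = pi q + pi n%:~R by exact: raddfD.
  have -> : pi n%:~R = 0 by apply/coker_pi_eq0; exists n.
  by rewrite addr0.
have [z0|nz] := eqVneq (pi ((q + 0%:~R) / k%:R)) 0; last first.
  by exists (pi ((q + 0%:~R) / k%:R)) => //; exact: piK.
exists (pi ((q + 1%:~R) / k%:R)); last exact: piK.
apply/eqP => z1.
have /coker_pi_eq0[n /(congr1 ( *%R^~ k%:R))] : pi (k%:R^-1) = 0.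
  rewrite -[LHS]/(pi k%:R^-1) -[RHS](subrr 0) -{1}z1 -z0 -raddfB -mulrBl.
  by rewrite opprD addrACA subrr add0r subr0 mul1r.
rewrite mulVf //= => /eqP.
rewrite [k%:R]pmulrn -[1]/(1%:~R) -intrM eqr_int => /eqP nk.
have /(congr1 absz) := nk; rewrite abszM /= => /eqP.
by rewrite muln_eq1 => /andP[_ /eqP k_eq1]; rewrite k_eq1 in k1.
Qed.

Lemma subgroup_mulz (V : zmodType) (P : V -> Prop) :
  P 0 -> (forall v w, P v -> P w -> P (v - w)) ->
  forall v (n : int), P v -> P (v *~ n).
Proof.
move=> P0 PB v n Pv.
have PN w : P w -> P (- w) by move=> ?; rewrite -sub0r; apply: PB.
have PM m : P (v *+ m).
  elim: m => [//|m IH]; rewrite mulrSr -[X in _ + X]opprK.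
  by apply: PB => //; exact: PN.
case: n => m; first by rewrite -pmulrn; exact: PM.
by rewrite NegzE mulrNz -pmulrn; exact/PN/PM.
Qed.

Section Extension.
Variables (A D : zmodType) (D_cog : injective_cogenerator D).
Implicit Types (G : set (A * D)) (a : A) (d : D).

(** Homomorphisms from a subgroup of [A] to [D] are encoded by their graphs, so
that the order of extension is inclusion and unions of chains are available. *)
Definition partial_hom G : Prop :=
  [/\ G 0, forall u v, G u -> G v -> G (u - v) & forall d, G (0, d) -> d = 0].

Lemma partial_homMz G u (n : int) : partial_hom G -> G u -> G (u *~ n).
Proof. by case=> G0 GB _; exact: subgroup_mulz. Qed.

Lemma pairMz a d (n : int) : (a, d) *~ n = (a *~ n, d *~ n).
Proof.
by apply: injective_projections;
  [exact: (raddfMz (@fst A D))|exact: (raddfMz (@snd A D))].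
Qed.

Lemma partial_hom_fun G a d e : partial_hom G -> G (a, d) -> G (a, e) -> d = e.
Proof.
case=> _ GB G1 Gd Ge; apply/eqP; rewrite -subr_eq0; apply/eqP/G1.
by have := GB _ _ Gd Ge; rewrite -[(a, d) - _]/(a - a, d - e) subrr.
Qed.

(** If some positive multiple of [a] lies in the domain, let [k > 1] be the least
such and [e] the value at [k a]: every value [d] at [a] with [k d = e] is
consistent, since the integers [n] with [n a] in the domain are the multiples of
[k].  Otherwise every [d] will do. *)
Lemma partial_hom_adjoin G a :
  partial_hom G -> (forall d, ~ G (a, d)) ->
  exists2 d, d != 0 &
    partial_hom [set u | exists n : int, G (u - (a, d) *~ n)].
Proof.
move=> pG Ga.
(* It is enough that [d] agrees with [G] on the multiples of [a] in its domain. *)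
suff [d d0 dP] : exists2 d, d != 0 &
    forall (n : int) e, G (a *~ n, e) -> e = d *~ n.
  exists d => //; case: (pG) => G0 GB G1; split=> [|u v [m Gm] [n Gn]|e [n]].
  - by exists 0; rewrite mulr0z subr0.
  - exists (m - n); have := GB _ _ Gm Gn; congr G.
    by rewrite mulrzBr !opprB [_ *~ n - v]addrC [LHS]addrACA [- _ + _]addrC.
  - rewrite pairMz => Gn; have := GB _ _ G0 Gn.
    rewrite sub0r -[- (_ - _)]/(- (0 - a *~ n), - (e - d *~ n)) !opprB subr0.
    by move/dP/eqP; rewrite -subr_eq0 addrAC subrr sub0r oppr_eq0 => /eqP.
have [tors|free] := pselect (exists k e, (0 < k)%N /\ G (a *+ k, e)); last first.
  have [d d0 _] := D_cog 0 (isT : (1 < 2)%N); exists d => // n e.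
  have [->|n0] := eqVneq n 0.
    by rewrite !mulr0z; case: pG => _ _; apply.
  move=> Gn; case: free; exists `|n|%N.
  have [p|p] := leP 0 n.
    by exists e; rewrite absz_gt0 pmulrn gez0_abs.
  exists (- e); rewrite absz_gt0 n0; split => //.
  rewrite pmulrn ltz0_abs // mulrNz.
  by have /= := partial_homMz (-1) pG Gn; rewrite mulrN1z.
have tors' : exists k, (0 < k)%N && `[< exists e, G (a *+ k, e) >].
  by case: tors => k [e [k0 Gk]]; exists k; rewrite k0; apply/asboolP; exists e.
case: (ex_minnP tors') => k /andP[k0 /asboolP[e Gk]] k_min.
have k1 : (1 < k)%N.
  by case: k k0 Gk {k_min} => [|[|k]] // _; rewrite mulr1n => /Ga.
have [d d0 dk] := D_cog e k1; exists d => // n e' Gn.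
have GM : G (a *~ (n %% k)%Z, e' - e *~ (n %/ k)%Z).
  have := partial_homMz (n %/ k)%Z pG Gk; case: pG => _ GB _ /(GB _ _ Gn).
  congr G; rewrite pairMz -[LHS]/(_ - _, _ - _); congr (_, _).
  by rewrite /modz mulrzBr [a *+ k]pmulrn -mulrzA [k%:Z * _]mulrC.
have kz : k%:Z != 0 by rewrite -lt0n.
have /eqP r0 : (n %% k)%Z == 0.
  move: GM (modz_ge0 n kz) (ltz_pmod n (k0 : 0 < k%:Z)).
  case: (n %% k)%Z => // r Gr _ rk; apply: contraLR rk => r0.
  rewrite -leNgt lez_nat; apply: k_min; rewrite lt0n r0 /=.
  by apply/asboolP; eexists; exact: Gr.
move: GM; rewrite r0 mulr0z; case: pG => _ _ G1 /G1/eqP; rewrite subr_eq0 => /eqP ->.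
by rewrite -dk pmulrn -mulrzA [n in RHS](divz_eq n k) r0 addr0 mulrC.
Qed.

(** A maximal extension is total, by [partial_hom_adjoin]. *)
Lemma partial_hom_extend G : partial_hom G ->
  exists psi : {additive A -> D}, forall a d, G (a, d) -> psi a = d.
Proof.
move=> pG.
(* Taking unions with [G] keeps the empty chain from being an exception. *)
have [F FF pF|H [pH Hmax]] := @Zorn_bigcup (A * D)%type
    [set H | partial_hom (G `|` H)%classic].
  have [[H FH]|F0] := pselect (exists H, F H); last first.
    rewrite /=; suff -> : (G `|` \bigcup_(X in F) X)%classic = G by [].
    apply/seteqP; split=> [u [//|[H FH]]|u Gu]; last by left.
    by case: F0; exists H.
  have GH u : (G `|` \bigcup_(X in F) X)%classic u <->
      exists2 H, F H & (G `|` H)%classic u.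
    split=> [[Gu|[K FK Ku]]|[K FK [Gu|Ku]]].
    - by exists H => //; left.
    - by exists K => //; right.
    - by left.
    - by right; exists K.
  split=> [|u v /GH[K FK Ku] /GH[L FL Lv]|d /GH[K FK]].
  - by left; case: pG.
  - apply/GH; have [KL|LK] := pF _ _ FK FL.
      exists L => //; case: (FF _ FL) => _ GB _; apply: GB => //.
      by case: Ku => [|/KL]; [left|right].
    exists K => //; case: (FF _ FK) => _ GB _; apply: GB => //.
    by case: Lv => [|/LK]; [left|right].
  - by case: (FF _ FK) => _ _; apply.
set K := (G `|` H)%classic in pH.
have Ktot a : exists d, K (a, d).
  apply: contrapT => Ka; have {}Ka d : ~ K (a, d) by move=> Kd; apply: Ka; exists d.
  have [d _ pL] := partial_hom_adjoin pH Ka.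
  set L := (X in partial_hom X) in pL.
  have KL u : K u -> L u by exists 0; rewrite mulr0z subr0.
  apply: (Hmax L).
    split=> [u Hu|LH]; first by apply: KL; right.
    apply: (Ka d); right; apply: LH; exists 1.
    by rewrite mulr1z subrr; case: pH.
  rewrite /= (_ : (G `|` L)%classic = L) //.
  by apply/seteqP; split=> [u [Gu|//]|u Lu]; [apply: KL; left|right].
pose psi a := projT1 (cid (Ktot a)).
have psiP a : K (a, psi a) by rewrite /psi; case: cid.
have psiB : zmod_morphism psi.
  move=> a b; apply: (partial_hom_fun pH (psiP _)).
  by case: pH => _ GB _; exact: GB (psiP a) (psiP b).
pose psi_add : {additive A -> D} :=
  HB.pack psi (GRing.isZmodMorphism.Build A D psi psiB).
exists psi_add => a d Gd.
by apply: (partial_hom_fun pH (psiP a)); left.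
Qed.

End Extension.

Section Divisible.
Variables (D : zmodType) (D_cog : injective_cogenerator D).

(** The graph to be extended is the image of [A] under [(f, phi)], which is a
partial homomorphism because [f] is injective. *)
Lemma additive_extend (A B : zmodType) (f : {additive A -> B})
    (phi : {additive A -> D}) :
  injective f -> exists psi : {additive B -> D}, forall a, psi (f a) = phi a.
Proof.
move=> f_inj.
have pG : partial_hom [set u : B * D | exists a, u = (f a, phi a)].
  split=> [|_ _ [a ->] [b ->]|d [a [fa ->]]].
  - by exists 0; rewrite !raddf0.
  - by exists (a - b); rewrite !raddfB.
  - by rewrite (f_inj a 0) ?raddf0.
have [psi psiP] := partial_hom_extend D_cog pG; exists psi => a.
by apply: psiP; exists a.
Qed.

(** If [a != 0], the zero homomorphism on the zero subgroup extends to [a] with a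
nonzero value, and then to [A]. *)
Lemma additive_separate (A : zmodType) (a : A) :
  (forall phi : {additive A -> D}, phi a = 0) -> a = 0.
Proof.
move=> phi0; have [//|a0] := eqVneq a 0.
have p0 : partial_hom [set 0 : A * D].
  by split=> [|_ _ -> ->|d [->]] //; rewrite subrr.
have [|d d0 pG] := @partial_hom_adjoin _ _ D_cog _ a p0.
  by move=> d [/eqP]; rewrite (negPf a0).
have [psi psiP] := partial_hom_extend D_cog pG.
case/eqP: d0; rewrite -(phi0 psi); apply/esym/psiP; exists 1.
by rewrite mulr1z subrr.
Qed.

End Divisible.

(** * Character modules *)

Section Dual.
Variables (R : pzRingType) (M : lmodType R^c).

Definition dual : Type := {additive M -> QZ}.

Lemma dualP (f g : dual) : f =1 g -> f = g.
Proof.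
case: f g => [f [[fA]]] [g [[gA]]] /= fg.
have {}fg : f = g by apply/funext.
by case: _ / fg gA => gA; rewrite (Prop_irrelevance fA gA).
Qed.

HB.instance Definition _ := gen_eqMixin dual.
HB.instance Definition _ := gen_choiceMixin dual.

Definition dual0 : dual := (\0 : {additive M -> QZ}).
Definition dualD (f g : dual) : dual := (f \+ g : {additive M -> QZ}).
Definition dualN (f : dual) : dual := (\- f : {additive M -> QZ}).
Definition dualZ (r : R) (f : dual) : dual :=
  (f \o ( *:%R (r : R^c)) : {additive M -> QZ}).

Lemma dualDA : associative dualD.
Proof. by move=> f g h; apply: dualP => x /=; rewrite addrA. Qed.
Lemma dualDC : commutative dualD.
Proof. by move=> f g; apply: dualP => x /=; rewrite addrC. Qed.
Lemma dual0D : left_id dual0 dualD.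
Proof. by move=> f; apply: dualP => x /=; rewrite add0r. Qed.
Lemma dualND : left_inverse dual0 dualN dualD.
Proof. by move=> f; apply: dualP => x /=; rewrite addNr. Qed.

HB.instance Definition _ :=
  GRing.isZmodule.Build dual dualDA dualDC dual0D dualND.

Lemma dualZA a b f : dualZ a (dualZ b f) = dualZ (a * b) f.
Proof. by apply: dualP => x /=; rewrite scalerA. Qed.
Lemma dualZ1 : left_id 1 dualZ.
Proof. by move=> f; apply: dualP => x /=; rewrite scale1r. Qed.
Lemma dualZDr : right_distributive dualZ +%R.
Proof. by move=> a f g; apply: dualP. Qed.
Lemma dualZDl f : {morph dualZ^~ f : a b / a + b}.
Proof. by move=> a b; apply: dualP => x /=; rewrite scalerDl raddfD. Qed.

HB.instance Definition _ :=
  GRing.Zmodule_isLmodule.Build R dual dualZA dualZ1 dualZDr dualZDl.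

Section Adjunction.
Variable X : lmodType R.

(** This lemma and the next give the two directions of the adjunction between
characters of M (x) X and linear maps from X to [dual M]. *)
Lemma tens_of_hom (k : {linear X -> dual}) :
  exists phi : {additive tens M X -> QZ},
    forall m x, phi (tens_pure m x) = (k x : {additive M -> QZ}) m.
Proof.
have kb : balanced (fun (m : M) (x : X) => (k x : {additive M -> QZ}) m).
  split=> [m m' x|m x x'|r m x]; first by rewrite raddfD.
  - by rewrite raddfD.
  - by rewrite linearZ.
by exists (tens_lift kb) => m x; exact: tens_lift_pure.
Qed.

Lemma hom_of_tens (phi : {additive tens M X -> QZ}) :
  exists k : {linear X -> dual},
    forall m x, (k x : {additive M -> QZ}) m = phi (tens_pure m x).
Proof.
have phiB x : zmod_morphism (fun m : M => phi (tens_pure m x)).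
  move=> m m'; rewrite -raddfB; congr (phi _); apply/eqP.
  by rewrite eq_sym subr_eq -tens_pureDl subrK.
pose k x : dual := (HB.pack_for {additive M -> QZ}
  (fun m : M => phi (tens_pure m x))
  (GRing.isZmodMorphism.Build M QZ _ (phiB x))).
have k_lin : linear k.
  move=> r x y; apply: dualP => m /=.
  by rewrite tens_pureDr raddfD -tens_pureZ.
pose kl : {linear X -> dual} :=
  HB.pack k (GRing.isLinear.Build R X dual *:%R k k_lin).
by exists kl.
Qed.

End Adjunction.
End Dual.

(** * Right exactness of the tensor product *)

Section TensorExact.
Variables (R : pzRingType) (M : lmodType R^c).

Lemma tens_pure0r (X : lmodType R) (m : M) : tens_pure m (0 : X) = 0.
Proof.
by apply: (@addrI _ (tens_pure m 0)); rewrite -tens_pureDr !addr0.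
Qed.

Lemma tens_ind (X : lmodType R) (P : tens M X -> Prop) :
  P 0 -> (forall s t, P s -> P t -> P (s - t)) ->
  (forall m x, P (tens_pure m x)) -> forall t, P t.
Proof.
move=> P0 PB Pp t; rewrite -(tens_pi_surj t).
elim/freeg_ind_dom0: (repr t) => [|k [m x] D _ _ IH]; first by rewrite raddf0.
have PN : P (tens_pure m x *~ (- k)).
  by apply: (subgroup_mulz P0 PB); exact: Pp.
have -> : << k *g (m, x) >> = << (m, x) >> *~ k :> tens_free M X.
  by rewrite freegU_mulz intz.
rewrite raddfD raddfMz /= addrC -[X in _ + X]opprK -mulrNz.
exact: PB IH PN.
Qed.

Variables (X Y Z : lmodType R) (f : {linear X -> Y}) (g : {linear Y -> Z}).

Lemma tens_surj : (forall z, exists y, g y = z) ->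
  forall t, exists s, tens_map (linid M) g s = t.
Proof.
move=> g_surj; elim/tens_ind => [|_ _ [s <-] [t <-]|m z].
- by exists 0; rewrite raddf0.
- by exists (s - t); rewrite raddfB.
- have [y <-] := g_surj z; exists (tens_pure m y); exact: tens_map_pure.
Qed.

(** Characters of M (x) Y that vanish on the image of M (x) X correspond to
linear maps Y -> [dual M] that kill the image of [f]; these factor through [g],
so the characters factor through M (x) Z.  Hence all of them kill the kernel of
M (x) g, and characters separate the points of the cokernel of M (x) f. *)
Lemma tens_exact : (forall z, exists y, g y = z) ->
  (forall y, g y = 0 <-> exists x, f x = y) ->
  forall t, tens_map (linid M) g t = 0 <->
            exists s, tens_map (linid M) f s = t.
Proof.
move=> g_surj fg_exact t; split=> [gt0|[s <-]]; last first.
  rewrite -tens_map_compr; elim/tens_ind: s => [|s s' s0 s0'|m x].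
  - exact: raddf0.
  - by rewrite raddfB s0 s0' subrr.
  - rewrite tens_map_pure /= (fg_exact _).2; last by exists x.
    by rewrite tens_pure0r.
apply/coker_pi_eq0/(additive_separate QZ_injective_cogenerator) => phi.
have [k kP] := hom_of_tens (phi \o coker_pi (tens_map (linid M) f)).
have k0 y : g y = 0 -> k y = 0.
  move=> /fg_exact[x <-]; apply: dualP => m; rewrite kP /= -[RHS](raddf0 phi).
  congr (phi _); apply/coker_pi_eq0; exists (tens_pure m x).
  exact: tens_map_pure.
have [k' k'P] := linear_factor g_surj k0.
have [phi' phi'P] := tens_of_hom k'.
have -> : phi (coker_pi (tens_map (linid M) f) t) =
          phi' (tens_map (linid M) g t).
  apply: (tens_ext (f := phi \o coker_pi (tens_map (linid M) f))
    (g := phi' \o tens_map (linid M) g)) => m y.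
  rewrite -kP -k'P -phi'P -[RHS]/(phi' (tens_map (linid M) g _)).
  by rewrite tens_map_pure.
by rewrite gt0 raddf0.
Qed.

End TensorExact.

(** R (x) X is X: acting by scalars sends [1 (x) x] back to [x]. *)
Lemma tens_unit_inj (R : pzRingType) (X Y : lmodType R) (f : {linear X -> Y}) :
  injective (tens_map (linid 'rV[R^c]_1) f) -> injective f.
Proof.
move=> f_inj x y fxy.
have hb : balanced (fun (v : 'rV[R^c]_1) (x : X) => (v 0 0 : R) *: x).
  split=> [v w z|v z w|r v z]; first by rewrite mxE scalerDl.
  - by rewrite scalerDr.
  - by rewrite mxE scalerA.
pose e : 'rV[R^c]_1 := const_mx 1.
have exy : tens_pure e x = tens_pure e y.
  by apply: f_inj; rewrite !tens_map_pure fxy.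
have := congr1 (tens_lift hb) exy.
by rewrite !tens_lift_pure !mxE !scale1r.
Qed.

Lemma fin_pres_free (R : pzRingType) n : fin_pres ('rV[R]_n : lmodType R).
Proof.
exists n, n, (lin0 _ _), (linid _); split=> [y|z]; last by exists z.
by split=> [/= ->|[x <-]] //; exists 0.
Qed.

(** * Presentations of functors and their values *)

Lemma abhom_sub0 (A B : abgrp) (p : abhom A B) x y :
  p x = p y -> p (abD x (abN y)) = ab0.
Proof. by move=> pxy; rewrite abhomD abhomN pxy abDC abND. Qed.

(** The universal property of a cokernel of functors; the factorization is
chosen objectwise, and is additive and natural because [p] is surjective. *)
Lemma nat_factor (C : preaddcat) (F G H K : functor C) (u : nattrans F G)
    (p : nattrans G H) (q : nattrans G K) :
  nat_exact u p -> nat_surj p -> (forall X x, q X (u X x) = ab0) ->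
  exists s : nattrans H K, forall X x, s X (p X x) = q X x.
Proof.
move=> up p_surj qu0.
pose r X y := projT1 (cid (p_surj X y)).
have pr X y : p X (r X y) = y by rewrite /r; case: cid.
pose s X y := q X (r X y).
have sp X x : s X (p X x) = q X x.
  have [w uw] : exists w, u X w = abD (r X (p X x)) (abN x).
    by apply/up/abhom_sub0; rewrite pr.
  have := qu0 X w; rewrite uw abhomD abhomN.
  move=> /(congr1 (fun t => abD t (q X x))).
  by rewrite -abDA abND ab0D abD0.
have sD X y z : s X (abD y z) = abD (s X y) (s X z).
  by rewrite -[in LHS](pr X y) -[in LHS](pr X z) -abhomD sp abhomD.
have sN X Y (f : mor X Y) y :
    AbHom (sD Y) (fmap H f y) = fmap K f (AbHom (sD X) y).
  by rewrite /= -[in LHS](pr X y) -natural sp natural.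
by exists (NatTrans sN).
Qed.

(** By the Yoneda lemma, maps of representables come from morphisms. *)
Lemma fp_presentation (C : preaddcat) (F : functor C) : fp_functor F ->
  exists (X Y : C) (f : mor X Y) (p : nattrans (rep X) F),
    nat_exact (rep_map f) p /\ nat_surj p.
Proof.
case=> X [Y [u [p [up p_surj]]]]; exists X, Y, (u Y (idm Y)), p; split=> //.
move=> W h; split=> [/up[k <-]|[k <-]].
  by exists k; rewrite -[k in RHS]cmpm1 (natural u k (idm Y)).
by apply/up; exists k; rewrite -[k in LHS]cmpm1 (natural u k (idm Y)).
Qed.

Section Modules.
Variable R : pzRingType.

(** The exactness of the representables says that [g] is a cokernel of [f].  It
gives back elementwise exactness when tested on the elementwise cokernels of [g]
(for surjectivity) and of [f] (for exactness in the middle). *)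
Lemma rep_cokernelP (X Y Z : LMod R) (f : mor X Y) (g : mor Y Z) :
  nat_inj (rep_map g) /\ nat_exact (rep_map g) (rep_map f) <->
  (forall z : (Z : lmodType R), exists y, (g : {linear Y -> Z}) y = z) /\
  (forall y : (Y : lmodType R), (g : {linear Y -> Z}) y = 0 <->
    exists x, (f : {linear X -> Y}) x = y).
Proof.
split=> [[g_inj fg]|[g_surj fg]]; split.
- move=> z; apply/(coker_proj_eq0 (g : {linear Y -> Z})).
  have /(congr1 (fun h : {linear Z -> _} => h z)) // :
    coker_proj (g : {linear Y -> Z}) = lin0 _ _.
  apply: (g_inj (coker_mod (g : {linear Y -> Z}) : lmodType R)).
  by apply: linP => y; apply/coker_proj_eq0; exists y.
- move=> y; split=> [gy|[x <-]].
    apply/(coker_proj_eq0 (f : {linear X -> Y})).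
    have [k kg] : exists k,
        rep_map g (coker_mod (f : {linear X -> Y}) : lmodType R) k =
        coker_proj (f : {linear X -> Y}).
      by apply/fg; apply: linP => x; apply/coker_proj_eq0; exists x.
    by rewrite -kg /= gy raddf0.
  have : rep_map f Z (rep_map g Z (idm Z)) = ab0 by apply/fg; exists (idm Z).
  by move=> /(congr1 (fun h : {linear X -> Z} => h x)).
- move=> N h h' hh'; apply: linP => z; have [y <-] := g_surj z.
  exact: (congr1 (fun h : {linear Y -> N} => h y) hh').
- move=> N h; split=> [hf|[k <-]].
    have hg y : (g : {linear Y -> Z}) y = 0 -> (h : {linear Y -> N}) y = 0.
      by move=> /fg[x <-]; exact: (congr1 (fun h : {linear X -> N} => h x) hf).
    have [k kP] := linear_factor g_surj hg.
    by exists k; exact: linP.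
  apply: linP => x /=; rewrite (fg _).2; last by exists x.
  exact: raddf0.
Qed.

(** By the Yoneda lemma, the natural transformations from [F] to M (x) - are the
elements of M (x) X killed by M (x) f, [s] corresponding to [s X (p X (idm X))]
and an element [t] to [p W h |-> (M (x) h) t]. *)
Lemma DA_eq0P (X Y : LMod R) (f : mor X Y) (F : functor (LMod R))
    (p : nattrans (rep X) F) : nat_exact (rep_map f) p -> nat_surj p ->
  is_zero (DA F) <->
  forall M : modR R, injective (tens_map (linid M) (f : {linear X -> Y})).
Proof.
move=> fp p_surj; split=> [DA0 M|f_inj M s].
  apply: raddf_inj => t ft0.
  pose q W (h : rep X W) : tensl M W :=
    tens_map (linid M) (h : {linear X -> W}) t.
  have qD W (h h' : rep X W) : q W (abD h h') = abD (q W h) (q W h').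
    exact: tens_mapDr.
  have qN W V (k : mor W V) h :
      AbHom (@qD V) (fmap (rep X) k h) = fmap (tensl M) k (AbHom (@qD W) h).
    exact: tens_map_compr.
  have [|s sp] := nat_factor (q := NatTrans qN) fp p_surj.
    move=> W k; rewrite /= /q tens_map_compr ft0; exact: raddf0.
  have := sp X (idm X).
  by rewrite (DA0 M s) /= /q tens_map_id.
apply: nattransP => W y; have [h <-] := p_surj W y.
rewrite -[h]cmpm1 (natural p h (idm X)) natural.
set t := s X _.
suff -> : t = 0 :> tens M X by exact: (raddf0 (tens_map (linid M) h)).
apply: (f_inj M); rewrite raddf0.
have := natural s f (p X (idm X)); rewrite -[fmap (tensl M) f _]/(tens_map _ _ t).
move=> <-; rewrite -natural /=.
rewrite (_ : p Y _ = ab0) ?abhom0 //; apply/fp; exists (idm Y).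
by rewrite /= lincompm1 lincomp1m.
Qed.

(** A morphism X -> [dual M] is a character of M (x) X; it extends to M (x) Y,
because M (x) X -> M (x) Y is injective.  Purity gives this injectivity for the
finitely presented M only. *)
Lemma dual_pure_injective (M : modR R) :
  pure_injective (dual M : lmodType R).
Proof.
move=> X Y Z f g [[f_inj fg g_surj] [tf_inj _ _]].
have [g_inj fg'] := (rep_cokernelP f g).2 (conj g_surj fg).
split; [exact: g_inj|exact: fg'|] => h.
have [phi phiP] := tens_of_hom (h : {linear X -> dual M}).
have [psi psiP] := additive_extend QZ_injective_cogenerator phi (tf_inj M).
have [k kP] := hom_of_tens psi.
exists k; apply: linP => x; apply: dualP => m; rewrite kP -phiP -psiP.
by congr (psi _); apply/esym; exact: tens_map_pure.
Qed.

(** Every character of M (x) X factors through M (x) f, hence kills the kernel of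
M (x) f. *)
Lemma dual_test_inj (M : lmodType R^c) (X Y : lmodType R)
    (f : {linear X -> Y}) :
  (forall h : {linear X -> dual M}, exists k : {linear Y -> dual M},
    lincomp k f = h) ->
  injective (tens_map (linid M) f).
Proof.
move=> f_ext; apply: raddf_inj => t ft0.
apply: (additive_separate QZ_injective_cogenerator) => phi.
have [h hP] := hom_of_tens phi; have [k kf] := f_ext h.
have [psi psiP] := tens_of_hom k.
have -> : phi t = psi (tens_map (linid M) f t).
  apply: (tens_ext (f := phi) (g := psi \o tens_map (linid M) f)) => m x.
  rewrite -hP -kf -[RHS]/(psi (tens_map (linid M) f _)).
  by rewrite tens_map_pure psiP.
by rewrite ft0 raddf0.
Qed.

End Modules.

(** * The equivalence *)

Theorem lemma5p3 (R : pzRingType) (F : functor (LMod R)) (hF : fp_functor F) :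
  [<-> is_zero (DA F);
       forall (X Y Z : LMod R) (f : mor X Y) (g : mor Y Z)
         (p : nattrans (rep X) F),
         rep_resolution f g p -> pure_exact f g;
       exists (X Y Z : LMod R) (f : mor X Y) (g : mor Y Z)
         (p : nattrans (rep X) F),
         pure_exact f g /\ rep_resolution f g p;
       forall N : LMod R, pure_injective N -> forall x : F N, x = ab0].
Proof.
tfae=> [DA0 X Y Z f g p [g_inj gf fp p_surj]|pure||N0].
- have [g_surj fg] := (rep_cokernelP f g).1 (conj g_inj gf).
  have tf_inj := (DA_eq0P fp p_surj).1 DA0.
  split; split=> //.
  + exact: (tens_unit_inj (tf_inj (FpMod (fin_pres_free R^c 1)))).
  + by move=> M t; exact: tens_exact.
  + by move=> M t; exact: tens_surj.
- have [X [Y [f [p [fp p_surj]]]]] := fp_presentation hF.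
  pose Z : LMod R := (coker_mod (f : {linear X -> Y}) : lmodType R).
  pose g : mor Y Z := coker_proj (f : {linear X -> Y}).
  have [g_inj gf] : nat_inj (rep_map g) /\ nat_exact (rep_map g) (rep_map f).
    apply/rep_cokernelP.
    by split; [exact: coker_proj_surj|exact: coker_proj_eq0].
  exists X, Y, Z, f, g, p; split; last by [].
  exact: (pure X Y Z f g p).
- move=> [X [Y [Z [f [g [p [fg [_ _ fp p_surj]]]]]]]] N N_inj x.
  have [h <-] := p_surj N x.
  by apply/fp; case: (N_inj _ _ _ _ _ fg) => _ _; apply.
- have [X [Y [f [p [fp p_surj]]]]] := fp_presentation hF.
  apply/(DA_eq0P fp p_surj) => M; apply: dual_test_inj => h.
  by apply/fp/N0/dual_pure_injective.
Qed.
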